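(* Let $H,K$ be Hilbert spaces, let $T:D(T)\subset H\to K$ be a densely defined linear operator and let $U:K\to K$ be unitary. Then, for all $f,g\in D(T)$, $$\langle UTf,UTg\rangle_K=\langle Tf,Tg\rangle_K.$$ Hence the quadratic forms generated by $UT$ and $T$ coincide. If $T$ is closable (respectively closed), then $UT$ is closable (respectively closed), and their closed form closures and associated nonnegative self-adjoint operators coincide.
   Context: The quadratic form generated by a densely defined operator $S:D(S)\subset H\to K$ is $f\mapsto\langle Sf,Sf\rangle_K$ with form domain $D(S)$. When $S$ is closable this form is closable, and its closure is a closed nonnegative densely defined form, which has an associated nonnegative self-adjoint operator on $H$ by the representation theorem for forms. *)

(* Defs.v *)
From HB Require Import structures.
From mathcomp Require Import all_boot all_order all_algebra.
From mathcomp Require Import sesquilinear.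
From mathcomp Require Import complex.
From mathcomp Require Import boolp classical_sets reals topology normedtype.

Set Implicit Arguments.
Unset Strict Implicit.
Unset Printing Implicit Defensive.

Import Order.TTheory GRing.Theory Num.Theory.
Import numFieldNormedType.Exports.

Local Open Scope classical_set_scope.
Local Open Scope ring_scope.

(* Hilbert spaces are either real or complex: [scalars R k] is R with the
   trivial conjugation or R[i] with complex conjugation. *)
Variant scalar_kind := RealScalars | ComplexScalars.

Definition scalars (R : realType) (k : scalar_kind) : numFieldType :=
  match k with RealScalars => R | ComplexScalars => complex R end.

Definition scalar_conj (R : realType) (k : scalar_kind) :
    scalars R k -> scalars R k :=
  match k with RealScalars => idfun | ComplexScalars => @Num.conj (complex R) end.

(* Following sesquilinear.v, inner products are linear in the first argument
   and theta-linear in the second one. *)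
HB.mixin Record NormedModule_hasInner (F : numFieldType) (theta : F -> F)
    H of NormedModule F H := {
  inner : {dot H for theta} ;
  inner_norm : forall x : H, (inner : H -> H -> F) x x = `|x| ^+ 2
}.

#[short(type="hilbertType")]
HB.structure Definition Hilbert (F : numFieldType) (theta : F -> F) :=
  { H of CompleteNormedModule F H & NormedModule_hasInner F theta H }.

Definition subspace (F : numFieldType) (V : lmodType F) (D : set V) : Prop :=
  D 0 /\ forall (a : F) (x y : V), D x -> D y -> D (a *: x + y).

(* A possibly unbounded operator; the values of [op_fun] outside [dom] are
   irrelevant, hence operators are compared with [op_eq]. *)
Record operator (F : numFieldType) (V W : lmodType F) := Operator {
  dom : set V ;
  op_fun :> V -> W ;
  dom_subspace : subspace dom ;
  op_linear : forall (a : F) (x y : V), dom x -> dom y ->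
    op_fun (a *: x + y) = a *: op_fun x + op_fun y
}.

Section Operators.
Context {F : numFieldType} {theta : F -> F} {H K : hilbertType theta}.
Implicit Types S T : operator H K.

Definition op_eq S T : Prop :=
  dom S = dom T /\ forall x, dom T x -> S x = T x.

Definition op_extends S T : Prop :=
  dom T `<=` dom S /\ forall x, dom T x -> S x = T x.

Definition graph T : set (H * K) := [set p | dom T p.1 /\ p.2 = T p.1].

Definition closed_op T : Prop := closed (graph T).

Definition closable_op T : Prop := exists S, op_extends S T /\ closed_op S.

Definition adjoint_graph T : set (K * H) :=
  [set p | forall x, dom T x -> inner (T x) p.1 = inner x p.2].

End Operators.

Section Compose.
Context {F : numFieldType} {V W W' : lmodType F}.
Variables (U : {linear W -> W'}) (T : operator V W).

Lemma op_comp_linear (a : F) (x y : V) : dom T x -> dom T y ->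
  U (T (a *: x + y)) = a *: U (T x) + U (T y).
Proof. by move=> Dx Dy; rewrite op_linear// linearP. Qed.

Definition op_comp : operator V W' :=
  @Operator _ _ _ (dom T) (fun x => U (T x)) (dom_subspace T) op_comp_linear.

End Compose.

Section OperatorsInH.
Context {F : numFieldType} {theta : F -> F} {H : hilbertType theta}.

(* U is bounded and U^* U = U U^* = 1, where V is U^*. *)
Definition unitary (U : {linear H -> H}) : Prop :=
  continuous U /\
  exists V : {linear H -> H},
    [/\ forall x y, inner (U x) y = inner x (V y), cancel U V & cancel V U].

Definition self_adjoint (A : operator H H) : Prop :=
  dense (dom A) /\ graph A = adjoint_graph A.

Definition nonneg_op (A : operator H H) : Prop :=
  forall f, dom A f -> 0 <= inner (A f) f.

End OperatorsInH.

(* A nonnegative quadratic form f |-> q f f with form domain [fdom q], carried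
   together with its polar sesquilinear form (f, g) |-> q f g. *)
Record nonneg_form (F : numFieldType) (theta : F -> F)
    (H : hilbertType theta) := NonnegForm {
  fdom : set H ;
  fval :> H -> H -> F ;
  fdom_subspace : subspace fdom ;
  fval_linear : forall (a : F) (f g h : H), fdom f -> fdom g -> fdom h ->
    fval (a *: f + g) h = a * fval f h + fval g h ;
  fval_sym : forall f g, fdom f -> fdom g -> fval f g = theta (fval g f) ;
  fval_ge0 : forall f, fdom f -> 0 <= fval f f
}.

Section GeneratedForm.
Context {F : numFieldType} {theta : F -> F} {H K : hilbertType theta}.
Variable S : operator H K.

Let gval (f g : H) : F := inner (S f) (S g).

Lemma op_form_linear (a : F) (f g h : H) : dom S f -> dom S g -> dom S h ->
  gval (a *: f + g) h = a * gval f h + gval g h.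
Proof. by move=> Df Dg _; rewrite /gval op_linear// linearPl. Qed.

Lemma op_form_sym (f g : H) : dom S f -> dom S g ->
  gval f g = theta (gval g f).
Proof. by move=> _ _; rewrite /gval hermitian_subproof expr0 mul1r. Qed.

Lemma op_form_ge0 (f : H) : dom S f -> 0 <= gval f f.
Proof. by move=> _; rewrite /gval inner_norm exprn_ge0. Qed.

(* the form f |-> <S f, S f> with form domain D(S) *)
Definition op_form : nonneg_form H :=
  @NonnegForm _ _ _ (dom S) gval (dom_subspace S)
    op_form_linear op_form_sym op_form_ge0.

End GeneratedForm.

Section Forms.
Context {F : numFieldType} {theta : F -> F} {H : hilbertType theta}.
Implicit Types p q : nonneg_form H.

Definition form_eq p q : Prop :=
  fdom p = fdom q /\ forall f g, fdom q f -> fdom q g -> p f g = q f g.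

Definition form_extends p q : Prop :=
  fdom q `<=` fdom p /\ forall f g, fdom q f -> fdom q g -> p f g = q f g.

Definition form_cvg q (u : nat -> H) (f : H) : Prop :=
  [/\ forall n, fdom q (u n),
      u @ \oo --> f &
      forall e : F, 0 < e ->
        \forall m & n \near \oo, q (u m - u n) (u m - u n) < e].

Definition closed_form q : Prop := forall (u : nat -> H) (f : H),
  form_cvg q u f ->
  fdom q f /\ (fun n => q (u n - f) (u n - f)) @ \oo --> (0 : F).

(* p is the closure of q, i.e. its smallest closed extension *)
Definition is_form_closure q p : Prop :=
  [/\ closed_form p, form_extends p q &
      forall p', closed_form p' -> form_extends p' q -> form_extends p' p].

(* A is the operator of the representation theorem for q: f is in D(A) with
   A f = h iff f is in D(q) and q f g = <h, g> for all g in D(q). *)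
Definition is_form_operator q (A : operator H H) : Prop :=
  dom A = [set f | fdom q f /\
                   exists h, forall g, fdom q g -> q f g = inner h g] /\
  forall f g, dom A f -> fdom q g -> q f g = inner (A f) g.

End Forms.

(* Main.v *)
Require Import Defs.
From HB Require Import structures.
From mathcomp Require Import all_boot all_order all_algebra.
From mathcomp Require Import sesquilinear complex ring.
From mathcomp Require Import boolp classical_sets reals topology normedtype.

Set Implicit Arguments.
Unset Strict Implicit.
Unset Printing Implicit Defensive.

Import Order.TTheory GRing.Theory Num.Theory.
Import numFieldNormedType.Exports.
Local Open Scope classical_set_scope.
Local Open Scope ring_scope.

(** A unitary [U] preserves inner products, so [op_comp U T] and [T] generate
    the same form; and [U] is isometric with an isometric inverse, so the graph
    of [op_comp U T] is closed as soon as that of [T] is. Everything that is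
    determined by the form alone, namely its closure and the operator of that
    closure, is therefore shared by the two operators. What needs work is that
    these objects exist.

    The closure of the form of a closable [T] is the form of the closure of [T]:
    the graph of a closable operator has a closure that is again a graph
    ([op_closure_exists]), a closed operator has a closed form
    ([closed_op_form]), and every closed extension of the form of [T] must
    contain the limits of sequences along which [T] converges, with the limiting
    values ([op_form_closure]).

    For the representation theorem, the heart is [closed_form_riesz]: if [q] is
    closed and [e > 0], the functional [<h, .>] is represented on [fdom q] by
    the form [<f, g> + e q(f, g)]. It is proved by minimizing the energy
    [<f, f> + e q(f, f) - 2 Re <h, f>]: midpoint convexity makes minimizing
    sequences Cauchy, closedness provides the limit, and the first variation
    there vanishes. For the operator [A] of [q] this says that [1 + e A] is
    onto [H]. With [e = 1], surjectivity turns the symmetric operator [A] into a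
    self-adjoint one; with [e] going to 0 it gives the density of [dom A], since
    the solution [f] of [f + e A f = g] satisfies [|g - f|^2 <= e q(g, g)].

    Real and complex scalars are treated at once: only the algebra of the
    conjugation and the Archimedean property of the order are used, and the
    latter replaces infima, which the partial order of the complex numbers does
    not provide. *)

(** * Scalars and limits *)

Section Scalars.
Context {R : realType} {k : scalar_kind}.
Local Notation F := (scalars R k).
Local Notation "x ^^*" := (@scalar_conj R k x) (at level 2, format "x ^^*").

Lemma conjD (x y : F) : (x + y)^^* = x^^* + y^^*.
Proof. by case: k x y => x y //=; rewrite rmorphD. Qed.

Lemma conjN (x : F) : (- x)^^* = - x^^*.
Proof. by case: k x => x //=; rewrite rmorphN. Qed.

Lemma conjM (x y : F) : (x * y)^^* = x^^* * y^^*.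
Proof. by case: k x y => x y //=; rewrite rmorphM. Qed.

Lemma conjK (x : F) : x^^*^^* = x.
Proof. by case: k x => x //=; rewrite conjCK. Qed.

Lemma mul_conj (x : F) : x * x^^* = `|x| ^+ 2.
Proof.
case: k x => x /=; last by rewrite normCK.
by rewrite real_normK ?num_real// expr2.
Qed.

Lemma conj_real (x : F) : x \is Num.real -> x^^* = x.
Proof. by case: k x => x //= /CrealP. Qed.

Lemma conj_ge0 (x : F) : 0 <= x -> x^^* = x.
Proof. by move/ger0_real/conj_real. Qed.

(** Strict comparison with a positive scalar forces the imaginary part to
    vanish, so the complex case reduces to the real one. *)
Lemma scalars_archimedean (x e : F) : x \is Num.real -> 0 < e ->
  exists n, x < e *+ n.
Proof.
suff arch (a b : R) : 0 < b -> exists n, a < b *+ n.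
  case: k x e => [|x e] /=; first by move=> x e _; exact: arch.
  case/complex_realP=> a -> e0; have /complex_realP[b eb] := gtr0_real e0.
  move: e0; rewrite eb ltcR => /(arch a)[n an]; exists n.
  by rewrite -rmorphMn ltcR.
move=> b0; exists (Num.trunc (a / b)).+1.
rewrite -mulr_natr mulrC -ltr_pdivrMr//.
exact: truncnS_gt.
Qed.

(** The discriminant inequality, with [N + 1] in place of [N] so that the
    degenerate case [N = 0] is not special. It serves both the Cauchy-Schwarz
    inequality of a form and the estimate of the first variation of an energy
    at a near minimizer. *)
Lemma norm_sqr_le_of_quadratic_ge0 (a e N : F) : 0 <= N ->
  (forall c : F, 0 <= e + c^^* * a + c * a^^* + c * c^^* * N) ->
  `|a| ^+ 2 <= e * (N + 1).
Proof.
move=> N0 pos; have N1 : 0 < N + 1 by rewrite ltr_wpDl.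
set t := (N + 1)^-1; have t0 : 0 < t by rewrite invr_gt0.
have tN : t * N <= 1 by rewrite mulrC ler_pdivrMr// mul1r lerDl.
(* c = - a / N would be optimal; N + 1 avoids dividing by 0 *)
rewrite -ler_pdivrMr// -subr_ge0; apply: le_trans (pos (- (t * a))) _.
rewrite conjN conjM (conj_ge0 (ltW t0)) -subr_ge0.
have -> : e - `|a| ^+ 2 / (N + 1) - (e + - (t * a^^*) * a + - (t * a) * a^^*
    + - (t * a) * - (t * a^^*) * N)
  = t * (a * a^^*) * (1 - t * N) + t * (a * a^^* - `|a| ^+ 2).
  by rewrite -/t; ring.
by rewrite mul_conj subrr mulr0 addr0 !mulr_ge0 ?exprn_ge0 ?subr_ge0 // ltW.
Qed.

Lemma harmonic_scalars_cvg0 : (fun n => n.+1%:R^-1 : F) @ \oo --> (0 : F).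
Proof.
apply/cvgr0Pnorm_lt => e e0.
have [|n ne] := @scalars_archimedean 1 e _ e0; first exact: real1.
near=> m; rewrite ger0_norm ?invr_ge0//.
rewrite invf_plt ?posrE// (lt_le_trans (_ : e^-1 < n%:R))//.
  by rewrite -div1r ltr_pdivrMr// mulrC mulr_natr.
by rewrite ler_nat ltnW// ltnS; near: m; exact: nbhs_infty_ge.
Unshelve. all: by end_near. Qed.

Lemma cvg0_mulr (b : nat -> F) (c : F) :
  b @ \oo --> (0 : F) -> (fun n => b n * c) @ \oo --> (0 : F).
Proof. by move=> b0; rewrite -(mul0r c); apply: cvgM => //; exact: cvg_cst. Qed.

Lemma cvg_of_dist_lt_harmonic (V : normedModType F) (u : nat -> V) (l : V) :
  (forall n, `|l - u n| < n.+1%:R^-1) -> u @ \oo --> l.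
Proof.
move=> ul; apply/cvgrPdist_lt => e e0.
have /cvgr0Pnorm_lt/(_ _ e0) := harmonic_scalars_cvg0.
apply: filterS => n; rewrite ger0_norm ?invr_ge0//.
by move/(lt_trans (ul n)).
Qed.

Lemma cvg0_of_sqr_le (V : normedModType F) (u : nat -> V) (b : nat -> F) :
  (forall n, `|u n| ^+ 2 <= b n) -> b @ \oo --> (0 : F) ->
  u @ \oo --> (0 : V).
Proof.
move=> ub /cvgr0Pnorm_lt b0; apply/cvgr0Pnorm_lt => e e0.
have e20 : 0 < e ^+ 2 by rewrite exprn_gt0.
apply: filterS (b0 _ e20) => n bn.
rewrite -(@ltr_pXn2r _ 2)// ?nnegrE// ?ltW//.
have un := ub n; have bn0 : 0 <= b n by apply: le_trans un; rewrite exprn_ge0.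
by apply: le_lt_trans un _; rewrite ger0_norm in bn.
Qed.

(** If no point came within [e] of being minimal, the values could be lowered
    by [e] again and again and would pass below [b] after finitely many steps.
    This stands in for the infimum of [J]. *)
Lemma near_minimizer (V : Type) (D : set V) (J : V -> F) (b e : F) :
  D !=set0 -> (forall f, D f -> b <= J f) ->
  (forall f, D f -> J f \is Num.real) ->
  0 < e -> exists2 f, D f & forall g, D g -> J f <= J g + e.
Proof.
move=> [f0 Df0] lb Jreal e0; apply: contrapT => noapprox.
have step f : D f -> exists2 g, D g & J g <= J f - e.
  move=> Df; apply: contrapT => nog; apply: noapprox; exists f => // g Dg.
  have [//|lt] := real_leP (Jreal _ Df) (realD (Jreal _ Dg) (gtr0_real e0)).
  by exfalso; apply: nog; exists g => //; rewrite lerBrDr ltW.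
have descend n : exists2 g, D g & J g <= J f0 - e *+ n.
  elim: n => [|n [g Dg Jg]]; first by exists f0 => //; rewrite subr0.
  have [g' Dg' Jg'] := step _ Dg; exists g' => //.
  by rewrite (le_trans Jg')// mulrSr opprD addrA lerD2r.
have breal : b \is Num.real.
  have := lb _ Df0; rewrite -subr_ge0 => /ger0_real bf.
  by rewrite -(subKr (J f0) b) rpredB// Jreal.
have [n bn] := scalars_archimedean (rpredB (Jreal _ Df0) breal) e0.
have [g Dg Jg] := descend n.
have := le_trans (lb _ Dg) Jg; rewrite lerBrDl -lerBrDr => /le_lt_trans/(_ bn).
by rewrite ltxx.
Qed.

Lemma near_both (P : set nat) : (\forall n \near \oo, P n) ->
  \forall m & n \near \oo, P m /\ P n.
Proof. by move=> nP; exists (P, P). Qed.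

Lemma sqr_cauchy_cvg (V : completeNormedModType F) (u : nat -> V) :
  (forall e : F, 0 < e -> \forall m & n \near \oo, `|u m - u n| ^+ 2 < e) ->
  exists l : V, u @ \oo --> l.
Proof.
move=> uC; apply/cvg_ex/cauchy_cvgP/cauchy_ballP => e e0; near_simpl.
have := uC _ (exprn_gt0 2 e0); apply: filterS => -[m n] /=.
by rewrite ltr_pXn2r// ?nnegrE// ?ltW// -ball_normE.
Qed.

(** Together with [sqr_cauchy_cvg] this lets Cauchy conditions be written with
    squared norms, which is what forms measure, without taking square roots. *)
Lemma cvg_sqr_cauchy (V : normedModType F) (u : nat -> V) (l : V) (e : F) :
  u @ \oo --> l -> 0 < e -> \forall m & n \near \oo, `|u m - u n| ^+ 2 < e.
Proof.
move=> ul e0; have e1 : 0 < 1 + e by rewrite addr_gt0.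
have r0 : 0 < e / (1 + e) / 2 by rewrite !divr_gt0.
move/cvgrPdist_lt/(_ _ r0)/near_both : ul; apply: filterS => -[m n] /= [lm ln].
(* e / (1 + e) is below both 1 and e, so smaller distances have squares below e *)
have lt : `|u m - u n| < e / (1 + e).
  rewrite (splitr (e / _)) (le_lt_trans (ler_distD l _ _))// ltrD//.
  by rewrite distrC.
apply: le_lt_trans (_ : `|u m - u n| * 1 < _).
  rewrite expr2 ler_wpM2l// ltW// (lt_trans lt)// ltr_pdivrMr// mul1r.
  by rewrite ltrDr.
rewrite mulr1 (lt_trans lt)// ltr_pdivrMr// mulrDr mulr1 ltrDl.
by rewrite mulr_gt0.
Qed.
End Scalars.

(** * Nonnegative forms *)

Section FormAlgebra.
Context {R : realType} {k : scalar_kind} {H : hilbertType (@scalar_conj R k)}.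
Local Notation F := (scalars R k).
Local Notation "x ^^*" := (@scalar_conj R k x) (at level 2, format "x ^^*").
Implicit Types q : nonneg_form H.

Lemma innerC (f g : H) : inner f g = (inner g f)^^*.
Proof. by rewrite hermitian_subproof expr0 mul1r. Qed.

Lemma inner_linear (a : F) (f g h : H) :
  inner (a *: f + g) h = a * inner f h + inner g h.
Proof. by rewrite linearPl. Qed.

Lemma inner_ge0 (f : H) : 0 <= inner f f.
Proof. by rewrite inner_norm exprn_ge0. Qed.

Lemma subspace_setT : Defs.subspace [set: H].
Proof. by split. Qed.

(** The inner product as an everywhere defined form, so that the lemmas on
    forms apply to it. *)
Definition inner_form : nonneg_form H :=
  NonnegForm subspace_setT (fun a f g h _ _ _ => inner_linear a f g h)
    (fun f g _ _ => innerC f g) (fun f _ => inner_ge0 f).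

Section OneForm.
Variable q : nonneg_form H.

Lemma fdomDZ (c : F) f g : fdom q f -> fdom q g -> fdom q (f + c *: g).
Proof. by move=> qf qg; rewrite addrC; apply: (fdom_subspace q).2. Qed.

Lemma fdomB f g : fdom q f -> fdom q g -> fdom q (f - g).
Proof. by move=> qf qg; rewrite -scaleN1r; exact: fdomDZ. Qed.

Lemma fvalDZl (c : F) f g h : fdom q f -> fdom q g -> fdom q h ->
  q (f + c *: g) h = q f h + c * q g h.
Proof. by move=> qf qg qh; rewrite addrC fval_linear// addrC. Qed.

Lemma fvalDZr (c : F) f g h : fdom q f -> fdom q g -> fdom q h ->
  q h (f + c *: g) = q h f + c^^* * q h g.
Proof.
move=> qf qg qh; rewrite fval_sym//; last exact: fdomDZ.
by rewrite fvalDZl// conjD conjM -!(fval_sym qh).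
Qed.

Lemma fvalBl f g h : fdom q f -> fdom q g -> fdom q h ->
  q (f - g) h = q f h - q g h.
Proof. by move=> qf qg qh; rewrite -scaleN1r fvalDZl// mulN1r. Qed.

Lemma fval_expand (c : F) f g : fdom q f -> fdom q g ->
  q (f + c *: g) (f + c *: g)
  = q f f + c^^* * q f g + c * (q f g)^^* + c * c^^* * q g g.
Proof.
move=> qf qg; rewrite fvalDZl ?fvalDZr//; try exact: fdomDZ.
by rewrite -(fval_sym qg)//; ring.
Qed.

(** The constant is not sharp, but it suffices for continuity and needs no
    separate treatment of vectors [g] with [q g g = 0]. *)
Lemma fval_weak_cauchy_schwarz f g : fdom q f -> fdom q g ->
  `|q f g| ^+ 2 <= q f f * (q g g + 1).
Proof.
move=> qf qg; apply: norm_sqr_le_of_quadratic_ge0; first exact: fval_ge0.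
by move=> c; rewrite -fval_expand//; apply/fval_ge0/fdomDZ.
Qed.

Lemma fval_cvgl (u : nat -> H) f g : (forall n, fdom q (u n)) -> fdom q f ->
  fdom q g -> (fun n => q (u n - f) (u n - f)) @ \oo --> (0 : F) ->
  (fun n => q (u n) g) @ \oo --> q f g.
Proof.
move=> qu qf qg qu0.
apply/subr_cvg0.
apply: (@cvg0_of_sqr_le _ _ F _ (fun n => q (u n - f) (u n - f) * (q g g + 1))).
  move=> n; rewrite -fvalBl//.
  by apply: fval_weak_cauchy_schwarz => //; exact: fdomB.
exact: cvg0_mulr.
Qed.

End OneForm.

Lemma innerDZr (c : F) (f g h : H) :
  inner h (f + c *: g) = inner h f + c^^* * inner h g.
Proof. exact: (fvalDZr (q := inner_form)). Qed.

Lemma inner_sub_expand (f g : H) :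
  inner (f - g) (f - g) = inner f f - inner f g - inner g f + inner g g.
Proof.
rewrite -scaleN1r; transitivity (inner f f + (-1)^^* * inner f g
    + -1 * (inner f g)^^* + -1 * (-1)^^* * inner g g).
  exact: (fval_expand (q := inner_form)).
by rewrite conjN (conj_real (real1 _)) -innerC; ring.
Qed.

Lemma inner_sub_cvg0 (u : nat -> H) f : u @ \oo --> f ->
  (fun n => inner (u n - f) (u n - f)) @ \oo --> (0 : F).
Proof.
move=> uf; under eq_fun do rewrite inner_norm expr2.
rewrite -(mulr0 (0 : F)); suff un : (fun n => `|u n - f|) @ \oo --> (0 : F).
  exact: cvgM.
by apply/norm_cvg0P; apply/subr_cvg0.
Qed.

Lemma inner_cvgl (u : nat -> H) f g : u @ \oo --> f ->
  (fun n => inner (u n) g) @ \oo --> inner f g.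
Proof. by move=> /inner_sub_cvg0; apply: (fval_cvgl (q := inner_form)). Qed.

Lemma dense_approx (D : set H) (x : H) (r : F) : 0 < r -> dense D ->
  exists2 g, D g & `|x - g| < r.
Proof.
move=> r0 Ddense.
have [||g []] := Ddense (ball x r); first by exists x; exact: ballxx.
  exact: ball_open.
by rewrite -ball_normE => xg Dg; exists g.
Qed.

Lemma dense_of_approx (D : set H) :
  (forall x r, 0 < r -> exists2 g, D g & `|x - g| < r) -> dense D.
Proof.
move=> approx O [x Ox] Oopen; have /nbhs_ballP[r /= r0 xrO] : nbhs x O.
  exact: open_nbhs_nbhs.
have [g Dg xg] := approx x r r0; exists g; split=> //.
by apply: xrO; rewrite -ball_normE.
Qed.

(** If [z = x - y] is orthogonal to [D], then [|z - g|^2 = |z|^2 + |g|^2] for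
    [g] in [D], so no element of [D] is closer to [z] than 0 is. *)
Lemma dense_inner_inj (D : set H) (x y : H) : dense D ->
  (forall g, D g -> inner x g = inner y g) -> x = y.
Proof.
move=> Ddense xy; apply/eqP; rewrite -subr_eq0 -normr_le0.
have [//|z0] := real_leP (normr_real _) (real0 _).
have [g Dg] := dense_approx (x - y) z0 Ddense.
rewrite -(@ltr_pXn2r _ 2)// ?nnegrE// -!inner_norm inner_sub_expand.
have E : inner (x - y) g = 0 by rewrite linearBl /= xy// subrr.
rewrite (innerC g) E conj_real ?real0// !subr0 gtrDl => /lt_le_trans.
by move=> /(_ _ (inner_ge0 g)); rewrite ltxx.
Qed.

Section Shift.
Variables (e : F) (e0 : 0 <= e) (q : nonneg_form H).
Let sval (f g : H) := inner f g + e * q f g.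

Lemma shift_linear (a : F) (f g h : H) : fdom q f -> fdom q g -> fdom q h ->
  sval (a *: f + g) h = a * sval f h + sval g h.
Proof. by move=> qf qg qh; rewrite /sval fval_linear// inner_linear; ring. Qed.

Lemma shift_sym f g : fdom q f -> fdom q g -> sval f g = (sval g f)^^*.
Proof.
move=> qf qg; rewrite /sval conjD conjM (conj_ge0 e0).
by rewrite -innerC -(fval_sym qf).
Qed.

Lemma shift_ge0 f : fdom q f -> 0 <= sval f f.
Proof. by move=> qf; rewrite addr_ge0 ?inner_ge0// mulr_ge0// fval_ge0. Qed.

(** The form [<f, g> + e q(f, g)] of the operator [1 + e A], when [A] is the
    operator of [q]. *)
Definition shift_form : nonneg_form H :=
  NonnegForm (fdom_subspace q) shift_linear shift_sym shift_ge0.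
End Shift.
End FormAlgebra.

(** * The representation theorem for closed forms *)

Section Representation.
Context {R : realType} {k : scalar_kind} {H : hilbertType (@scalar_conj R k)}.
Local Notation F := (scalars R k).
Local Notation "x ^^*" := (@scalar_conj R k x) (at level 2, format "x ^^*").
Variable q : nonneg_form H.

Hypothesis q_closed : closed_form q.

Section Riesz.
Variables (e : F) (h : H).
Hypothesis e0 : 0 < e.
Local Notation Q := (shift_form (ltW e0) q).
(** Up to the constant [<h, h>] this is [|h - f|^2 + e q(f, f)]. *)
Definition energy (f : H) : F := Q f f - inner h f - (inner h f)^^*.
Local Notation J := energy.

(** The coefficient of [c^^*] is the first variation of the energy at [f] in the
    direction [g], and the energy is exactly quadratic along lines. *)
Lemma energy_expand (c : F) f g : fdom q f -> fdom q g ->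
  J (f + c *: g) = J f + c^^* * (Q f g - inner h g) +
    c * (Q f g - inner h g)^^* + c * c^^* * Q g g.
Proof.
move=> qf qg; rewrite /energy (@fval_expand _ _ _ Q)//.
rewrite innerDZr.
by rewrite !(conjD, conjN, conjM, conjK); ring.
Qed.

Lemma energy_ge f : fdom q f -> - (inner h h) <= J f.
Proof.
move=> qf; rewrite -subr_ge0.
have -> : J f - - inner h h = inner (f - h) (f - h) + e * q f f.
  by rewrite inner_sub_expand /energy /= -innerC; ring.
by rewrite addr_ge0 ?inner_ge0// mulr_ge0 ?fval_ge0// ltW.
Qed.

Lemma energy_real f : fdom q f -> J f \is Num.real.
Proof.
move=> qf; rewrite -[J f](addrNK (- inner h h)) rpredD//.
  by apply: ger0_real; rewrite subr_ge0 energy_ge.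
by rewrite rpredN ger0_real// inner_ge0.
Qed.

Lemma energy_minimizing_sequence : exists u : nat -> H,
  forall n, fdom q (u n) /\ forall g, fdom q g -> J (u n) <= J g + n.+1%:R^-1.
Proof.
suff /choice[u uP] : forall n, exists f,
  fdom q f /\ forall g, fdom q g -> J f <= J g + n.+1%:R^-1 by exists u.
move=> n; have q0 : fdom q !=set0 by exists 0; exact: (fdom_subspace q).1.
have n0 : 0 < n.+1%:R^-1 :> F by rewrite invr_gt0 ltr0n.
by have [f] := near_minimizer q0 energy_ge energy_real n0; exists f.
Qed.

(** Strong convexity: by comparison with their midpoint, two near minimizers
    are close to each other for the form [Q]. *)
Lemma energy_parallelogram f g (a b : F) : fdom q f -> fdom q g ->
  (forall f', fdom q f' -> J f <= J f' + a) ->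
  (forall f', fdom q f' -> J g <= J f' + b) ->
  Q (g - f) (g - f) <= 2 * (a + b).
Proof.
move=> qf qg fmin gmin; have qd : fdom q (g - f) by exact: fdomB.
have qm : fdom q (f + 2^-1 *: (g - f)) by exact: fdomDZ.
have := lerD (fmin _ qm) (gmin _ qm).
(* the energies at f, at the midpoint and at g are values of one quadratic *)
have {1}-> : g = f + 1 *: (g - f) by rewrite scale1r addrC subrK.
have half_conj : (2^-1 : F)^^* = 2^-1 by rewrite conj_ge0// invr_ge0.
rewrite !energy_expand// (conj_real (real1 _)) half_conj.
set A := Q f _ - _; set B := A^^*; set D := Q _ _; rewrite -subr_ge0 => le.
rewrite -subr_ge0; have -> : 2 * (a + b) - D =
    2 * (J f + 2^-1 * A + 2^-1 * B + 2^-1 * 2^-1 * D + a +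
         (J f + 2^-1 * A + 2^-1 * B + 2^-1 * 2^-1 * D + b) -
         (J f + (J f + 1 * A + 1 * B + 1 * 1 * D))).
  by field.
by rewrite mulr_ge0.
Qed.

(** The Riesz representation of [<h, .>] in the space [fdom q] normed by
    [<f, f> + e q(f, f)], which is complete because [q] is closed. *)
Lemma closed_form_riesz :
  exists2 f, fdom q f & forall g, fdom q g -> inner (h - f) g = e * q f g.
Proof.
have [u umin] := energy_minimizing_sequence.
have qu n := (umin n).1.
have uQ m n : Q (u m - u n) (u m - u n) <= 2 * (n.+1%:R^-1 + m.+1%:R^-1).
  by apply: energy_parallelogram => //; apply: (umin _).2.
have small (d : F) : 0 < d ->
    \forall m & n \near \oo, Q (u m - u n) (u m - u n) < d.
  move=> d0; have d40 : 0 < d / 2 / 2 by rewrite !divr_gt0.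
  have /cvgr0Pnorm_lt/(_ _ d40)/near_both := @harmonic_scalars_cvg0 R k.
  apply: filterS => -[m n] /= [md nd]; apply: le_lt_trans (uQ m n) _.
  rewrite !ger0_norm ?invr_ge0// in md nd.
  by rewrite -ltr_pdivlMl// mulrC [ltRHS]splitr ltrD.
have [f uf] : exists f : H, u @ \oo --> f.
  apply: sqr_cauchy_cvg => d /small; apply: filterS => -[m n] /=.
  apply: le_lt_trans; rewrite -inner_norm lerDl mulr_ge0 ?(ltW e0)//.
  by rewrite fval_ge0//; exact: fdomB.
have [|qf qu0] := q_closed (u := u) (f := f).
  split=> // d d0; have := small _ (mulr_gt0 e0 d0).
  apply: filterS => -[m n] /= lt.
  rewrite -(ltr_pM2l e0); apply: le_lt_trans lt.
  by rewrite lerDr inner_ge0.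
exists f => // g qg; apply/eqP; rewrite -subr_eq0.
suff : inner h g - Q f g = 0.
  by move=> <- /=; rewrite linearBl /=; apply/eqP; ring.
have Quf0 : (fun n => Q (u n - f) (u n - f)) @ \oo --> (0 : F).
  suff : (fun n => inner (u n - f) (u n - f) + e * q (u n - f) (u n - f))
      @ \oo --> (0 + e * 0 : F) by rewrite mulr0 addr0.
  apply: cvgD; first exact: inner_sub_cvg0.
  by apply: cvgM => //; exact: cvg_cst.
have lim1 := fval_cvgl (q := Q) qu qf qg Quf0.
(* n.+1^-1 bounds how much the energy can drop below its value at u n, so it
   bounds the first variation at u n *)
have lim2 : (fun n => Q (u n) g - inner h g) @ \oo --> (0 : F).
  apply: (@cvg0_of_sqr_le _ _ F _ (fun n => n.+1%:R^-1 * (Q g g + 1)));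
    last exact/cvg0_mulr/harmonic_scalars_cvg0.
  move=> n; apply: norm_sqr_le_of_quadratic_ge0.
    exact: (fval_ge0 (n := Q)).
  move=> c; have := (umin n).2 _ (fdomDZ c (qu n) qg).
  rewrite energy_expand// -subr_ge0; congr (0 <= _); ring.
have lim3 : (fun n => Q (u n) g - inner h g) @ \oo --> Q f g - inner h g.
  by apply: cvgB => //; exact: cvg_cst.
by rewrite -opprB (cvg_unique _ lim3 lim2) ?oppr0.
Qed.
End Riesz.

Hypothesis q_dense : dense (fdom q).

(** Density of [fdom q] makes the vector [h] representing [q f] unique, and
    uniqueness is what makes the chosen values depend linearly on [f]. *)
Lemma form_operator_exists : exists A : operator H H, is_form_operator q A.
Proof.
pose P f h := forall g, fdom q g -> q f g = inner h g.
pose D : set H := [set f | fdom q f /\ exists h, P f h].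
have : forall f, exists h, D f -> P f h.
  move=> f; have [[_ [h fh]]|] := pselect (D f); first by exists h.
  by move=> nDf; exists 0.
case/choice=> a aP.
have PL (c : F) f g hf hg : D f -> D g -> P f hf -> P g hg ->
    P (c *: f + g) (c *: hf + hg).
  move=> [qf _] [qg _] fh gh x qx.
  by rewrite fval_linear// inner_linear fh// gh.
have Dsub : Defs.subspace D.
  split=> [|c f g Df Dg].
    split; first exact: (fdom_subspace q).1.
    exists 0 => g qg; rewrite linear0l -(subrr (0 : H)) fvalBl ?subrr//.
      exact: (fdom_subspace q).1.
    exact: (fdom_subspace q).1.
  split; first by apply: (fdom_subspace q).2; [case: Df | case: Dg].
  by exists (c *: a f + a g); apply: PL => //; exact: aP.
have alin (c : F) f g : D f -> D g -> a (c *: f + g) = c *: a f + a g.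
  move=> Df Dg; apply: (dense_inner_inj q_dense) => x qx.
  have /aP aL : D (c *: f + g) by exact: Dsub.2.
  by rewrite -aL// (PL c f g (a f) (a g))//; exact: aP.
by exists (Operator Dsub alin); split => //= f g /aP; apply.
Qed.

Variable A : operator H H.
Hypothesis qA : is_form_operator q A.

Lemma form_operator_fdom f : dom A f -> fdom q f.
Proof. by rewrite qA.1 => -[]. Qed.

Lemma form_operatorE f g : dom A f -> fdom q g -> q f g = inner (A f) g.
Proof. exact: qA.2. Qed.

Lemma form_operator_intro f h : fdom q f ->
  (forall g, fdom q g -> q f g = inner h g) -> dom A f /\ A f = h.
Proof.
move=> qf fh; have Af : dom A f by rewrite qA.1; split=> //; exists h.
split=> //; apply: (dense_inner_inj q_dense) => g qg.
by rewrite -fh// form_operatorE.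
Qed.

Lemma form_operator_nonneg : nonneg_op A.
Proof.
move=> f Af; have qf := form_operator_fdom Af.
by rewrite -form_operatorE// fval_ge0.
Qed.

Lemma form_operator_symmetric f g : dom A f -> dom A g ->
  inner (A f) g = inner f (A g).
Proof.
move=> Af Ag.
have qf := form_operator_fdom Af; have qg := form_operator_fdom Ag.
by rewrite (innerC f) -!form_operatorE// -fval_sym.
Qed.

(** The Riesz solution [f] satisfies [q f g = <e^-1 (h - f), g>] on [fdom q],
    which is membership in [dom A] with [A f = e^-1 (h - f)]. *)
Lemma form_operator_resolvent (e : F) (h : H) : 0 < e ->
  exists2 f, dom A f & f + e *: A f = h.
Proof.
move=> e0; have [f qf fh] := closed_form_riesz h e0.
have [g qg|Af Afh] := @form_operator_intro f (e^-1 *: (h - f)) qf.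
  by rewrite linearZl_LR /= fh// mulKf// gt_eqF.
by exists f => //; rewrite Afh scalerA divff ?gt_eqF// scale1r addrC subrK.
Qed.

(** Testing [g - f = e A f] against [g - f] gives
    [|g - f|^2 = e q(f, g) - e q(f, f)], which is real, and
    [2 Re q(f, g) <= q(f, f) + q(g, g)]. *)
Lemma form_operator_resolvent_dist (e : F) f g : 0 < e -> dom A f ->
  fdom q g -> f + e *: A f = g -> inner (g - f) (g - f) <= e * q g g.
Proof.
move=> e0 Af qg fg; have qf := form_operator_fdom Af.
have gfE : inner (g - f) (g - f) = e * q f g - e * q f f.
  rewrite -{1}fg addrC addKr linearZl_LR /=.
  rewrite -form_operatorE//; last exact: fdomB.
  by rewrite -scaleN1r fvalDZr// conjN (conj_real (real1 _)); ring.
have gf_real : inner (g - f) (g - f) = e * q g f - e * q f f.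
  rewrite -[LHS](conj_ge0 (inner_ge0 _)) gfE conjD conjN !conjM.
  by rewrite -(fval_sym qg qf) -(fval_sym qf qf) (conj_ge0 (ltW e0)).
rewrite -subr_ge0 -(@pmulr_rge0 _ 2)//.
have -> : 2 * (e * q g g - inner (g - f) (g - f)) =
    e * (q (g - f) (g - f) + q f f + q g g).
  transitivity (2 * (e * q g g) - inner (g - f) (g - f)
      - inner (g - f) (g - f)); first by ring.
  rewrite {1}gfE gf_real -[in RHS]scaleN1r fval_expand// conjN.
  by rewrite (conj_real (real1 _)) -(fval_sym qf qg); ring.
rewrite mulr_ge0 ?(ltW e0)// !addr_ge0 ?fval_ge0//; exact: fdomB.
Qed.

(** A vector [g] of the dense set [fdom q] is the limit of the solutions [f] in
    [dom A] of [f + e A f = g] as [e] goes to 0. *)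
Lemma form_operator_dense : dense (dom A).
Proof.
apply: dense_of_approx => x r r0.
have r20 : 0 < r / 2 by rewrite divr_gt0.
have [g qg xg] := dense_approx x r20 q_dense.
have qg0 := fval_ge0 qg.
have q1 : 0 < q g g + 1 by rewrite ltr_wpDl.
have e0 : 0 < (r / 2) ^+ 2 / (q g g + 1) by rewrite divr_gt0// exprn_gt0.
have [f Af fg] := form_operator_resolvent g e0.
exists f => //.
have le := form_operator_resolvent_dist e0 Af qg fg.
have gf : `|g - f| < r / 2.
  rewrite -(@ltr_pXn2r _ 2)// ?nnegrE// ?(ltW r20)// -inner_norm.
  apply: le_lt_trans le _; rewrite mulrAC ltr_pdivrMr//.
  by rewrite ltr_pM2l ?exprn_gt0// ltrDl.
by rewrite (splitr r) (le_lt_trans (ler_distD g _ _))// ltrD.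
Qed.

(** If [(y, z)] is in the adjoint graph, solve [f + A f = y + z] with [f] in
    [dom A]; then [y - f] is orthogonal to the range of [1 + A], which is the
    whole space, so [y = f] and [z = A f]. *)
Lemma form_operator_self_adjoint : self_adjoint A.
Proof.
split; first exact: form_operator_dense.
apply/seteqP; split=> -[y z] /=.
  by case=> /= Ay -> x Ax; exact: form_operator_symmetric.
move=> yz; have [f Af fE] := form_operator_resolvent (y + z) ltr01.
rewrite scale1r in fE.
suff yf : y = f by move: fE; rewrite yf => /addrI <-.
apply/eqP; rewrite -subr_eq0; apply/eqP.
have [x Ax xE] := form_operator_resolvent (y - f) ltr01.
apply/eqP; rewrite -normr_eq0 -sqrf_eq0 -inner_norm -{1}xE scale1r.
rewrite linearDl !linearBr /= (yz x Ax) (form_operator_symmetric Ax Af).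
have : inner x (y + z) = inner x (f + A f) by rewrite fE.
rewrite !linearDr /= => /eqP; rewrite -subr_eq0 => /eqP E.
by rewrite -[X in _ == X]E; apply/eqP; ring.
Qed.
End Representation.

(** * Closable operators and their forms *)

Section ClosableOperators.
Context {R : realType} {k : scalar_kind} {H K : hilbertType (@scalar_conj R k)}.
Local Notation F := (scalars R k).
Implicit Types S T : operator H K.

Lemma opB S f g : dom S f -> dom S g -> S (f - g) = S f - S g.
Proof.
by move=> Sf Sg; rewrite -scaleN1r addrC op_linear// scaleN1r addrC.
Qed.

Lemma domB S f g : dom S f -> dom S g -> dom S (f - g).
Proof. by move=> Sf Sg; exact: (@fdomB _ _ _ (op_form S)). Qed.

Lemma graph_closure_seqP T (f : H) (h : K) : closure (graph T) (f, h) <->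
  exists u : nat -> H, [/\ forall n, dom T (u n), u @ \oo --> f &
    (fun n => T (u n)) @ \oo --> h].
Proof.
split=> [Tfh|[u [Tu uf Tuh]] B fhB].
  suff /choice[u uP] : forall n, exists g, [/\ dom T g,
      `|f - g| < n.+1%:R^-1 & `|h - T g| < n.+1%:R^-1].
    exists u; split=> [n||]; first by have [] := uP n.
      by apply: cvg_of_dist_lt_harmonic => n; have [] := uP n.
    by apply: cvg_of_dist_lt_harmonic => n; have [] := uP n.
  move=> n; have n0 : 0 < n.+1%:R^-1 :> F by rewrite invr_gt0 ltr0n.
  have [[g g'] [[/= Tg ->] [/=]]] := Tfh _ (nbhsx_ballx (f, h) _ n0).
  by rewrite -!ball_normE; exists g.
have : (fun n => (u n, T (u n))) @ \oo --> (f, h) by exact: cvg_pair.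
move=> /(_ _ fhB) Bnear; have /filter_ex[n Bn] : \forall n \near \oo,
    B (u n, T (u n)) by [].
by exists (u n, T (u n)); split=> //; split=> //=.
Qed.

Lemma closed_opP S : closed_op S <->
  forall f h, closure (graph S) (f, h) -> dom S f /\ h = S f.
Proof.
by split=> [Scl f h /Scl//|Scl [f h] /Scl].
Qed.

(** The closure of the graph of [T] lies in the graph of any closed extension
    [S], hence is the graph of a restriction of [S]. *)
Lemma op_closure_exists T : closable_op T ->
  exists Tb : operator H K, graph Tb = closure (graph T).
Proof.
case=> S [[TS STE] Scl].
have GS f h : closure (graph T) (f, h) -> dom S f /\ h = S f.
  move=> Tfh; apply: (closed_opP S).1 => //; move: Tfh.
  apply: closure_subset => -[x y] [/= Tx ->].
  by split; [exact: TS | rewrite -STE].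
pose D : set H := [set f | closure (graph T) (f, S f)].
have DS f : D f -> dom S f by move/GS => [].
have Dsub : Defs.subspace D.
  have T0 := (dom_subspace T).1.
  split; first by apply: subset_closure; split=> //=; rewrite STE.
  move=> c f g Df Dg; rewrite /D/=.
  rewrite op_linear; [|exact: DS..].
  move: Df => /graph_closure_seqP[u [Tu uf Su]].
  move: Dg => /graph_closure_seqP[v [Tv vg Sv]].
  apply/graph_closure_seqP; exists (fun n => c *: u n + v n); split.
  - by move=> n; apply: (dom_subspace T).2.
  - by apply: cvgD => //; apply: cvgZr.
  - under eq_fun do rewrite op_linear//.
    by apply: cvgD => //; apply: cvgZr.
have lin (c : F) f g : D f -> D g -> S (c *: f + g) = c *: S f + S g.
  by move=> /DS Sf /DS Sg; exact: op_linear.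
exists (Operator Dsub lin); apply/seteqP; split=> -[f h] /=.
  by case=> /= Df ->.
by move=> Tfh; have [_ E] := GS _ _ Tfh; split; rewrite /= ?/D/= -?E.
Qed.

(** A sequence that is Cauchy for the form has Cauchy images under [S]; these
    converge as the target space is complete, and the graph is closed. *)
Lemma closed_op_form S : closed_op S -> closed_form (op_form S).
Proof.
move=> Scl u f [/= Su uf uC].
have [h Suh] : exists h : K, (fun n => S (u n)) @ \oo --> h.
  apply: sqr_cauchy_cvg => e /uC; apply: filterS => -[m n] /=.
  by rewrite opB// inner_norm.
have [|/= Sf hE] := (closed_opP S).1 Scl f h.
  by apply/graph_closure_seqP; exists u.
split=> //; under eq_fun do rewrite opB//.
by apply: inner_sub_cvg0; rewrite -hE.
Qed.

Section Closure.
Variables T Tb : operator H K.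
Hypothesis TbE : graph Tb = closure (graph T).

Lemma op_closure_dom f : dom T f -> dom Tb f /\ Tb f = T f.
Proof.
move=> Tf; have : graph Tb (f, T f) by rewrite TbE; exact: subset_closure.
by case.
Qed.

Lemma op_closure_seq f : dom Tb f -> exists u : nat -> H,
  [/\ forall n, dom T (u n), u @ \oo --> f & (fun n => T (u n)) @ \oo --> Tb f].
Proof.
by move=> Tf; apply/graph_closure_seqP; rewrite -TbE.
Qed.

Lemma closed_op_closure : closed_op Tb.
Proof. by rewrite /closed_op TbE; exact: closed_closure. Qed.

(** Along a sequence on which [T] converges, [p] agrees with the form of [T],
    so the sequence is Cauchy for [p] and closedness of [p] applies. *)
Lemma closed_extension_seq (p : nonneg_form H) f (u : nat -> H) (h : K) :
  closed_form p -> form_extends p (op_form T) -> (forall n, dom T (u n)) ->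
  u @ \oo --> f -> (fun n => T (u n)) @ \oo --> h ->
  fdom p f /\ forall g, fdom p g -> (fun n => p (u n) g) @ \oo --> p f g.
Proof.
move=> pcl [/= Tp pE] Tu uf Tuh; have pu n := Tp _ (Tu n).
have [|pf puf] := pcl u f.
  split=> // e /(cvg_sqr_cauchy Tuh); apply: filterS => -[m n] /=.
  by rewrite pE ?opB// -?inner_norm//; exact: domB.
by split=> // g pg; exact: fval_cvgl.
Qed.

(** The values of a closed extension on [dom Tb] are forced by continuity,
    passing to the limit in one argument at a time. *)
Lemma op_form_closure : is_form_closure (op_form T) (op_form Tb).
Proof.
split=> [||p pcl pT]; first exact/closed_op_form/closed_op_closure.
  split=> [f /op_closure_dom[]//|f g /op_closure_dom[_ fE]].
  move=> /op_closure_dom[_ gE] /=.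
  by rewrite fE gE.
have [/= Tp pE] := pT.
have pb f : dom Tb f -> fdom p f.
  move=> /op_closure_seq[u [Tu uf Tuf]].
  by have [] := closed_extension_seq pcl pT Tu uf Tuf.
have half f g : dom T f -> dom Tb g -> p f g = inner (T f) (Tb g).
  move=> Tf Tg; have [u [Tu ug Tug]] := op_closure_seq Tg.
  have [_ /(_ _ (Tp _ Tf)) lim] := closed_extension_seq pcl pT Tu ug Tug.
  rewrite (fval_sym (Tp _ Tf) (pb _ Tg)) innerC; congr (scalar_conj _).
  suff : (fun n => p (u n) f) @ \oo --> inner (Tb g) (T f) by exact: cvg_unique.
  by rewrite (eq_cvg _ _ (fun n => pE _ _ (Tu n) Tf)); exact: inner_cvgl.
split=> //= f g Tf Tg; have [u [Tu uf Tuf]] := op_closure_seq Tf.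
have [_ /(_ _ (pb _ Tg)) lim] := closed_extension_seq pcl pT Tu uf Tuf.
suff : (fun n => p (u n) g) @ \oo --> inner (Tb f) (Tb g) by exact: cvg_unique.
by rewrite (eq_cvg _ _ (fun n => half _ _ (Tu n) Tg)); exact: inner_cvgl.
Qed.
End Closure.
End ClosableOperators.

(** * Uniqueness of closures and of form operators *)

Section FormEquality.
Context {R : realType} {k : scalar_kind} {H : hilbertType (@scalar_conj R k)}.
Implicit Types p q : nonneg_form H.

Lemma form_eq_sym p q : form_eq p q -> form_eq q p.
Proof.
case=> dE vE; split; first by rewrite dE.
by move=> f g pf pg; rewrite vE// -dE.
Qed.

Lemma form_eq_extends p q : form_eq p q -> form_extends p q.
Proof. by case=> dE vE; split; rewrite ?dE. Qed.

Lemma form_extends_trans p q r :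
  form_extends p q -> form_extends q r -> form_extends p r.
Proof.
move=> [qp pE] [rq qE]; split; first exact: subset_trans qp.
by move=> f g rf rg; rewrite pE ?qE//; exact: rq.
Qed.

Lemma form_extends_anti p q :
  form_extends p q -> form_extends q p -> form_eq p q.
Proof. by move=> [qp pE] [pq _]; split=> //; exact/seteqP. Qed.

Lemma is_form_closure_eq p p' q : form_eq p p' ->
  is_form_closure p q -> is_form_closure p' q.
Proof.
move=> pp' [qcl qp qmin]; split=> //.
  exact: form_extends_trans qp (form_eq_extends pp').
move=> r rcl rp'; apply: qmin => //.
exact: form_extends_trans rp' (form_eq_extends (form_eq_sym pp')).
Qed.

Lemma is_form_closure_unique p q1 q2 :
  is_form_closure p q1 -> is_form_closure p q2 -> form_eq q1 q2.
Proof.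
move=> [cl1 ext1 min1] [cl2 ext2 min2].
by apply: form_extends_anti; [exact: min2 | exact: min1].
Qed.

Lemma is_form_operator_unique q1 q2 (A1 A2 : operator H H) : dense (fdom q2) ->
  form_eq q1 q2 -> is_form_operator q1 A1 -> is_form_operator q2 A2 ->
  op_eq A1 A2.
Proof.
move=> q2d [dE vE] qA1 qA2.
have A12 f : dom A1 f -> dom A2 f /\ A2 f = A1 f.
  move=> A1f; have q1f := form_operator_fdom qA1 A1f.
  apply: (form_operator_intro q2d qA2); first by rewrite -dE.
  by move=> g q2g; rewrite -vE -?dE// ?(form_operatorE qA1)// dE.
have A21 f : dom A2 f -> dom A1 f.
  move=> A2f; have q2f := form_operator_fdom qA2 A2f.
  rewrite qA1.1; split; first by rewrite dE.
  exists (A2 f) => g; rewrite dE => q2g; rewrite vE//.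
  exact: (form_operatorE qA2).
split; first by apply/seteqP; split=> f; [move/A12 => [] | exact: A21].
by move=> f /A21/A12[_ ->].
Qed.

End FormEquality.

(** * Composition with a unitary operator *)

Section Unitary.
Context {R : realType} {k : scalar_kind} {H K : hilbertType (@scalar_conj R k)}.

Lemma unitary_inner (U : {linear K -> K}) x y : unitary U ->
  inner (U x) (U y) = inner x y.
Proof. by case=> _ [V [UV VK _]]; rewrite UV VK. Qed.

Lemma unitary_norm (U : {linear K -> K}) x : unitary U -> `|U x| = `|x|.
Proof.
move=> Uu; apply/eqP; rewrite -(@eqrXn2 _ 2)//.
by rewrite -!inner_norm unitary_inner.
Qed.

(** If [U (S (u n))] converges to [h], then [S (u n)] converges to [U^-1 h],
    because [U] preserves distances. *)
Lemma closed_op_comp_unitary (S : operator H K) (U : {linear K -> K}) :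
  unitary U -> closed_op S -> closed_op (op_comp U S).
Proof.
move=> Uu Scl; apply/closed_opP => f h /graph_closure_seqP[u [/= Su uf USu]].
have [_ [V [_ _ VK]]] := Uu.
have [|Sf hE] := (closed_opP S).1 Scl f (V h).
  apply/graph_closure_seqP; exists u; split=> //.
  apply/cvgrPdist_lt => e e0; move/cvgrPdist_lt/(_ _ e0) : USu.
  by apply: filterS => n; rewrite -(unitary_norm (V h - _) Uu) linearB /= VK.
by rewrite -(VK h) hE.
Qed.

End Unitary.

Theorem lemma11p8 (R : realType) (k : scalar_kind)
    (H K : hilbertType (@scalar_conj R k))
    (T : operator H K) (U : {linear K -> K}) :
  dense (dom T) -> unitary U ->
  let UT : operator H K := op_comp U T in
  [/\ forall f g : H, dom T f -> dom T g ->
        inner (UT f) (UT g) = inner (T f) (T g),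
      form_eq (op_form UT) (op_form T),
      closable_op T -> closable_op UT,
      closed_op T -> closed_op UT &
      closable_op T ->
        (exists (q : nonneg_form H) (A : operator H H),
           [/\ is_form_closure (op_form T) q,
               is_form_closure (op_form UT) q,
               dense (fdom q),
               is_form_operator q A &
               self_adjoint A /\ nonneg_op A]) /\
        (forall q1 q2 : nonneg_form H,
           is_form_closure (op_form UT) q1 -> is_form_closure (op_form T) q2 ->
           form_eq q1 q2 /\
           forall A1 A2 : operator H H,
             is_form_operator q1 A1 -> is_form_operator q2 A2 ->
             op_eq A1 A2)].
Proof.
move=> Tdense Uu UT.
have innerE f g : inner (UT f) (UT g) = inner (T f) (T g).
  exact: unitary_inner.
have formE : form_eq (op_form UT) (op_form T).
  by split=> // f g _ _; exact: innerE.
have closure_dense q : is_form_closure (op_form T) q -> dense (fdom q).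
  case=> _ [Tq _] _ O O0 /(Tdense _ O0)[x [Ox Tx]].
  by exists x; split=> //; exact: Tq.
split=> //.
- case=> S [[TS ST] Scl]; exists (op_comp U S); split.
    by split=> //= f Tf; rewrite ST.
  exact: closed_op_comp_unitary.
- exact: closed_op_comp_unitary.
- move=> Tclosable; split=> [|q1 q2 UTq1 Tq2].
    have [Tb TbE] := op_closure_exists Tclosable.
    have Tq := op_form_closure TbE; have qd := closure_dense _ Tq.
    have [A qA] := form_operator_exists qd.
    have qcl : closed_form (op_form Tb) by case: Tq.
    exists (op_form Tb), A; split=> //.
      exact: is_form_closure_eq (form_eq_sym formE) Tq.
    split; first exact: form_operator_self_adjoint qA.
    exact: form_operator_nonneg qA.
  have q12 : form_eq q1 q2.
    apply: is_form_closure_unique Tq2.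
    exact: is_form_closure_eq formE UTq1.
  split=> // A1 A2; apply: is_form_operator_unique => //.
  exact: closure_dense Tq2.
Qed.
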